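(* Adding an edge to the network $\mathcal{G}^P$, or increasing its susceptance (decreasing the reactance), can only decrease the expected power losses associated with the measurement noise, $$\|\mathcal{S}^{\mathrm{DAPI}}_\eta\|_2^2=\varepsilon^2\frac{\alpha}{2k}\sum_{i=2}^n\frac{1}{\gamma\lambda_i}\cdot\frac{1}{1+\varphi(\lambda_i,\gamma,k,q,\tau)},$$ and vice versa (removing an edge, or decreasing its susceptance, can only increase these losses).
   Context: $\mathcal{G}^P=(\mathcal{V},\mathcal{E}^P)$ is a connected undirected graph on the node set $\mathcal{V}=\{1,\dots,n\}$ with edge weights (susceptances) $b_{ij}=b_{ji}>0$ for $(i,j)\in\mathcal{E}^P$ and $b_{ij}=0$ otherwise. $\mathcal{L}_B$ is its weighted Laplacian ($[\mathcal{L}_B]_{ij}=-b_{ij}$ for $i\neq j$, $[\mathcal{L}_B]_{ii}=\sum_{j\ne i}b_{ij}$), with eigenvalues $0=\lambda_1<\lambda_2\le\dots\le\lambda_n$. The function $\varphi$ is $$\varphi(\lambda_i,\gamma,k,q,\tau)=\frac{kq^2\lambda_i+q\gamma\lambda_i+\tau(\gamma\lambda_i)^2}{q+\tau\gamma\lambda_i}.$$ The displayed quantity is the part due to frequency measurement noise $\eta$ of the squared $\mathcal{H}_2$ norm (expected transient resistive power losses) of the power network under distributed averaging proportional-integral (DAPI) control, $$\dot\theta=\omega,\qquad \tau\dot\omega=-k\mathcal{L}_B\theta-\omega+\Omega+P,\qquad q\dot\Omega=-\omega-\gamma\mathcal{L}_B\Omega+\eta,$$ with output $y=\mathcal{L}_G^{1/2}\theta$,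 where $\theta$, $\omega$ and $\Omega$ are the vectors of phase angles, frequency deviations and integral states, $P$ is unit-intensity white power injection noise, and $\eta=\varepsilon w_\eta$ with $w_\eta$ unit-intensity white noise uncorrelated with $P$. The matrix $\mathcal{L}_G=\alpha\mathcal{L}_B$ is the conductance Laplacian, where $\alpha=g_{ij}/b_{ij}$ is the uniform and constant ratio of line conductance $g_{ij}$ to susceptance. The parameters $k$ (droop gain), $\tau$ (time constant), $q$ (integral gain), $\gamma$ (averaging gain) and $\varepsilon$ (noise intensity) are positive scalars, uniform over the nodes. The communication graph used for averaging the integral states is identical to $\mathcal{G}^P$, with weights $c_{ij}=\gamma b_{ij}$. *)

(* Defs.v *)
From HB Require Import structures.
From mathcomp Require Import all_boot all_order all_algebra.
From mathcomp Require Import all_classical all_reals all_analysis.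

Set Implicit Arguments.
Unset Strict Implicit.
Unset Printing Implicit Defensive.

Import Order.TTheory GRing.Theory Num.Theory.
Import numFieldNormedType.Exports.

Local Open Scope classical_set_scope.
Local Open Scope ring_scope.

Record power_network (R : realType) (n : nat) := PowerNetwork {
  edge : rel 'I_n;
  susceptance : 'I_n -> 'I_n -> R;
  edge_sym : symmetric edge;
  edge_irrefl : irreflexive edge;
  edge_connected : forall i j, connect edge i j;
  susceptance_sym : forall i j, susceptance i j = susceptance j i;
  susceptance_gt0 : forall i j, edge i j -> 0 < susceptance i j;
  susceptance_eq0 : forall i j, ~~ edge i j -> susceptance i j = 0 }.

Definition laplacian (R : realType) (n : nat) (G : power_network R n) : 'M[R]_n :=
  \matrix_(i, j) if i == j then \sum_(k < n | k != i) susceptance G i k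
                 else - susceptance G i j.

(* lam lists the eigenvalues of A, with multiplicity, in nondecreasing order;
   indices start at 0, so the smallest eigenvalue lambda_1 is lam 0. *)
Definition ordered_eigenvalues (R : realType) (n : nat) (A : 'M[R]_n)
    (lam : 'I_n -> R) : Prop :=
  char_poly A = \prod_(i < n) ('X - (lam i)%:P) /\
  (forall i j : 'I_n, (i <= j)%N -> lam i <= lam j).

(* The symmetric positive semidefinite square root of A; it exists and is unique
   when A is itself symmetric positive semidefinite (0 is returned if there is
   none). *)
Definition psd_sqrt (R : realType) (n : nat) (A : 'M[R]_n) : 'M[R]_n :=
  xget 0 [set S : 'M[R]_n | [/\ S^T = S,
    (forall x : 'cV[R]_n, 0 <= (x^T *m S *m x) 0 0) & S *m S = A]].

(* The matrix exponential, as the entrywise sum of the series of A^k / k!. *)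
Definition mxexp (R : realType) (N : nat) (A : 'M[R]_N) : 'M[R]_N :=
  \matrix_(i, j) limn (series (fun k : nat => (A ^+ k) i j / k`!%:R)).

(* Squared H2 norm of dx/dt = A x + B w, y = C x: the energy of the impulse
   response h(t) = C exp(tA) B, which is also the steady-state variance of y
   under unit-intensity white noise w. It is +oo if the integral diverges. A need
   not be Hurwitz: modes on the imaginary axis may be unobservable. *)
Definition H2_norm_sq (R : realType) (N m p : nat)
    (A : 'M[R]_N) (B : 'M[R]_(N, m)) (C : 'M[R]_(p, N)) : \bar R :=
  \int[lebesgue_measure]_(t in `[0%R, +oo[)
    (let h := C *m mxexp (t *: A) *m B in (\tr (h^T *m h))%:E).

Section DAPI.
Variables (R : realType) (n : nat) (alpha k tau q gamma eps : R).
Variable G : power_network R n.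

(* The state is the stacked vector (theta, omega, Omega). *)
Definition dapi_state_mx : 'M[R]_(n + (n + n)) :=
  let L := laplacian G in
  block_mx 0                        (row_mx 1%:M 0)
           (col_mx (- (k / tau) *: L)
                   0)               (block_mx (- tau^-1)%:M tau^-1%:M
                                              (- q^-1)%:M   (- (gamma / q) *: L)).

(* Input matrix for w_eta, where eta = eps w_eta enters q dOmega/dt. The part of
   the squared H2 norm due to eta is that of the system with P = 0. *)
Definition dapi_noise_mx : 'M[R]_(n + (n + n), n) :=
  col_mx 0 (col_mx 0 (eps / q)%:M).

(* y = L_G^(1/2) theta, where L_G = alpha L_B. *)
Definition dapi_output_mx : 'M[R]_(n, n + (n + n)) :=
  row_mx (psd_sqrt (alpha *: laplacian G)) 0.

Definition dapi_noise_loss : \bar R :=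
  H2_norm_sq dapi_state_mx dapi_noise_mx dapi_output_mx.

End DAPI.

Definition phi (R : realType) (lam gamma k q tau : R) : R :=
  (k * q ^+ 2 * lam + q * gamma * lam + tau * (gamma * lam) ^+ 2) /
  (q + tau * gamma * lam).

Section EdgeChanges.
Variables (R : realType) (n : nat) (i j : 'I_n).

Definition same_except_at (G G' : power_network R n) : Prop :=
  forall u v : 'I_n, [set u; v]%SET != [set i; j]%SET ->
    edge G' u v = edge G u v /\ susceptance G' u v = susceptance G u v.

Definition adds_edge (G G' : power_network R n) : Prop :=
  [/\ same_except_at G G', ~~ edge G i j & edge G' i j].

Definition increases_susceptance (G G' : power_network R n) : Prop :=
  [/\ same_except_at G G', edge G i j, edge G' i j
    & susceptance G i j < susceptance G' i j].

(* Both networks are connected, being of type power_network; in particular the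
   removed edge is not a bridge. *)
Definition removes_edge (G G' : power_network R n) : Prop :=
  [/\ same_except_at G G', edge G i j & ~~ edge G' i j].

Definition decreases_susceptance (G G' : power_network R n) : Prop :=
  [/\ same_except_at G G', edge G i j, edge G' i j
    & susceptance G' i j < susceptance G i j].

End EdgeChanges.

(* Main.v *)
Require Import Defs.
From HB Require Import structures.
From mathcomp Require Import all_boot all_order all_algebra all_fingroup.
From mathcomp Require Import all_classical all_reals all_analysis.
From mathcomp Require Import measurable_realfun complex ring lra.

Set Implicit Arguments.
Unset Strict Implicit.
Unset Printing Implicit Defensive.

Import Order.TTheory GRing.Theory Num.Theory.
Import numFieldNormedType.Exports.

Local Open Scope classical_set_scope.
Local Open Scope ring_scope.

(** The Laplacian [L] is symmetric, so an orthonormal eigenbasis [Q] splits the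
    closed loop into [n] scalar third-order systems, one for each eigenvalue
    [l] of [L], and the squared H2 norm is the sum of the squared norms of these
    modes ([dapi_noise_lossE]). The output weight of the mode [l] is [alpha * l], so
    the mode [l = 0] is not seen at the output, although it is not stable.

    For [l > 0] the energy of the impulse response of a mode is found by
    Lyapunov's method: there is a quadratic form [V] of the state whose
    derivative along the motion is [- theta ^ 2], so that the integral of
    [theta ^ 2] over the half-line is [V] at time [0], provided that the state
    tends to [0] ([integral_by_lyapunov]). Decay follows from a second form, the
    physical energy corrected by a small multiple of [theta * omega], which
    decreases at an exponential rate ([mode_lyapunov]). The value of [V] at the
    initial state is [theta_energy]; multiplied by the output weight it is the
    stated summand up to constant factors.

    The summand decreases in [l > 0], because [phi] increases. Adding an edge or
    raising a susceptance raises the Laplacian quadratic form, which is a sum of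
    terms [b u v * (x u - x v) ^ 2], and hence, by the argument of Courant and
    Fischer, raises each eigenvalue ([eigenvalue_le]). Connectedness enters here:
    it makes all eigenvalues but the first positive, so the summands stay on the
    branch where monotonicity holds. The opposite change is the same statement
    with the two networks exchanged. *)

(** * Spectral theorem for real symmetric matrices *)

Lemma sqnorm_row_ge0 (R : realDomainType) n (v : 'rV[R]_n) :
  0 <= (v *m v^T) 0 0.
Proof.
by rewrite mxE sumr_ge0 // => i _; rewrite mxE -expr2 sqr_ge0.
Qed.

Lemma sqnorm_row_eq0 (R : realDomainType) n (v : 'rV[R]_n) :
  ((v *m v^T) 0 0 == 0) = (v == 0).
Proof.
apply/eqP/eqP => [|->]; last by rewrite mul0mx mxE.
rewrite mxE => /eqP; rewrite psumr_eq0 => [/allP v0|i _]; last first.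
  by rewrite mxE -expr2 sqr_ge0.
apply/rowP => i; have := v0 i (mem_index_enum _).
by rewrite /= !mxE -expr2 sqrf_eq0 => /eqP.
Qed.

(** An eigenvalue exists over the complex numbers, and it is real because the
    Hermitian form [v A v^*] is real at a corresponding eigenvector [v]. *)
Lemma symmetric_eigenvalue (R : rcfType) n (A : 'M[R]_n.+1) :
  A^T = A -> exists a, eigenvalue A a.
Proof.
move=> symA; pose C := map_mx (real_complex R) A.
have [z zC] := eigenvalue_closed C (ltn0Sn n).
have [v vCz v0] := eigenvalueP zC.
have Cadj : (C^T ^ Num.conj)%sesqui = C.
  apply/matrixP => i j; rewrite !mxE -[in RHS]symA mxE.
  by apply/CrealP/complex_realP; exists (A j i).
pose s := (v *m (v^T ^ Num.conj)%sesqui) 0 0.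
have sE : s = \sum_i `|v 0 i| ^+ 2.
  by rewrite /s mxE; apply: eq_bigr => i _; rewrite !mxE normCK.
have s0 : s != 0.
  rewrite sE psumr_eq0 => [|i _]; last by rewrite exprn_ge0.
  apply: contraNN v0 => /allP v0; apply/eqP/rowP => i.
  have := v0 i (mem_index_enum _); rewrite /= sqrf_eq0 normr_eq0 => /eqP ->.
  by rewrite mxE.
have sreal : Num.conj s = s.
  apply/CrealP; rewrite sE; apply: rpred_sum => i _.
  by apply: rpredX; exact: normr_real.
(* The Hermitian form equals both [z * s] and its conjugate. *)
have zE : (v *m C *m (v^T ^ Num.conj)%sesqui) 0 0 = z * s.
  by rewrite vCz -scalemxAl mxE.
have zreal : Num.conj z = z.
  apply: (mulIf s0); rewrite -zE -{1}sreal -rmorphM -zE.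
  pose t := v *m C *m (v^T ^ Num.conj)%sesqui.
  have tE : (t^T ^ Num.conj)%sesqui = t.
    rewrite /t !trmx_mul !map_mxM /= Cadj mulmxA; congr (_ *m _ *m _).
    by apply/matrixP => i j; rewrite !mxE conjCK.
  by rewrite -/t -[in RHS]tE !mxE.
have /complex_realP [a za] : z \is Num.real by apply/CrealP.
exists a; rewrite eigenvalue_root_char.
move: zC; rewrite eigenvalue_root_char /C -map_char_poly za fmorph_root.
by [].
Qed.

(** The Householder reflection in the hyperplane orthogonal to [v - e]. *)
Lemma reflection_to_unit (R : rcfType) n (v e : 'rV[R]_n) :
  (v *m v^T) 0 0 = 1 -> (e *m e^T) 0 0 = 1 ->
  exists H : 'M[R]_n, [/\ H^T = H, H *m H = 1%:M & v *m H = e].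
Proof.
move=> v1 e1; have [->|ve] := eqVneq v e.
  by exists 1%:M; rewrite trmx1 !mulmx1.
have [w wE] : exists w, w = v - e by exists (v - e).
pose c := (w *m w^T) 0 0.
have c0 : c != 0 by rewrite sqnorm_row_eq0 wE subr_eq0.
have scal (x y : 'rV[R]_n) : x *m y^T = ((x *m y^T) 0 0)%:M.
  by rewrite -mx11_scalar.
have vw : (v *m w^T) 0 0 = c / 2.
  have subE (x y : 'M[R]_1) : (x - y) 0 0 = x 0 0 - y 0 0 by rewrite !mxE.
  have comm : (e *m v^T) 0 0 = (v *m e^T) 0 0.
    by rewrite -{1}[e]trmxK -trmx_mul mxE.
  have xw (x : 'rV[R]_n) : (x *m w^T) 0 0 = (x *m v^T) 0 0 - (x *m e^T) 0 0.
    by rewrite wE raddfB /= mulmxBr subE.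
  have -> : c = (v *m w^T) 0 0 - (e *m w^T) 0 0.
    by rewrite /c {1}wE mulmxBl subE.
  by rewrite !xw v1 e1 comm; field.
exists (1%:M - (2 / c) *: (w^T *m w)); split.
- by rewrite linearB /= trmx1 linearZ /= trmx_mul trmxK.
- rewrite mulmxBl !mulmxBr !mulmx1 mul1mx -scalemxAl -scalemxAr.
  rewrite [w^T *m w *m _]mulmxA -[w^T *m w *m w^T]mulmxA (scal w w) -/c.
  rewrite mul_mx_scalar -scalemxAl !scalerA.
  have -> : 2 / c * (2 / c) * c = 2 / c + 2 / c by field.
  by rewrite scalerDl opprB addrK subrK.
- rewrite mulmxBr mulmx1 -scalemxAr mulmxA scal vw mul_scalar_mx scalerA.
  have -> : 2 / c * (c / 2) = 1 by field.
  by rewrite scale1r wE opprB addrC subrK.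
Qed.

(** Induction on the size: a reflection that carries a unit eigenvector to the
    first coordinate vector makes the matrix block diagonal. *)
Lemma symmetric_diagonalization (R : rcfType) n (A : 'M[R]_n) :
  A^T = A -> exists (Q : 'M[R]_n) (d : 'rV[R]_n),
    Q^T *m Q = 1%:M /\ A = Q *m diag_mx d *m Q^T.
Proof.
elim: n A => [|n IHn] A symA.
  by exists 1%:M, 0; split; apply/matrixP => -[].
have [a /eigenvalueP [u uA u0]] := symmetric_eigenvalue symA.
pose s := Num.sqrt ((u *m u^T) 0 0); pose v := s^-1 *: u.
have s2 : s ^+ 2 = (u *m u^T) 0 0 by rewrite sqr_sqrtr ?sqnorm_row_ge0.
have s0 : s != 0 by rewrite -sqrf_eq0 s2 sqnorm_row_eq0.
have v1 : (v *m v^T) 0 0 = 1.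
  rewrite /v linearZ /= -scalemxAl -scalemxAr scalerA mxE -s2.
  by field.
have vA : v *m A = a *: v.
  by rewrite /v -scalemxAl uA !scalerA mulrC.
pose e : 'rV[R]_(1 + n) := row_mx 1%:M 0.
have e1 : (e *m e^T) 0 0 = 1.
  by rewrite /e tr_row_mx mul_row_col trmx1 mulmx1 mul0mx addr0 mxE.
have [H [symH HH vH]] := reflection_to_unit v1 e1.
have eH : e *m H = v by rewrite -vH -mulmxA HH mulmx1.
pose B : 'M[R]_(1 + n) := H *m A *m H.
have symB : B^T = B by rewrite /B !trmx_mul symH symA mulmxA.
have eB : e *m B = a *: e.
  by rewrite /B !mulmxA eH vA -scalemxAl vH.
have BE : B = block_mx a%:M 0 0 (drsubmx B).
  have := eB; rewrite -{1}[B]submxK /e mul_row_block !mul1mx !mul0mx !addr0.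
  rewrite scale_row_mx scaler0 => /eq_row_mx [ul ur].
  have dl : dlsubmx B = 0.
    by rewrite -[dlsubmx B]trmxK trmx_dlsub symB ur trmx0.
  by rewrite -{1}[B]submxK ul ur dl scalemx1.
have symD : (drsubmx B)^T = drsubmx B by rewrite trmx_drsub symB.
have [Q [d [QQ BQ]]] := IHn _ symD.
pose P : 'M[R]_(1 + n) := block_mx 1%:M 0 0 Q.
have PP : P^T *m P = 1%:M.
  rewrite /P tr_block_mx trmx1 !trmx0 mulmx_block.
  by rewrite !(mulmx0, mul0mx, mulmx1, addr0, add0r) QQ -scalar_mx_block.
pose D : 'rV[R]_(1 + n) := row_mx a%:M d.
have BP : B = P *m diag_mx D *m P^T.
  rewrite BE BQ /P /D tr_block_mx trmx1 !trmx0 diag_mx_row !mulmx_block.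
  rewrite !(mulmx0, mul0mx, mulmx1, mul1mx, addr0, add0r).
  by congr block_mx; apply/matrixP => i j; rewrite !mxE !ord1 eqxx.
exists (H *m P), D; split.
  by rewrite trmx_mul symH -mulmxA [H *m (H *m P)]mulmxA HH mul1mx.
have AE : A = H *m B *m H.
  by rewrite /B !mulmxA HH mul1mx -mulmxA HH mulmx1.
by rewrite [LHS]AE BP trmx_mul symH !mulmxA.
Qed.

Definition eigenbasis (R : comPzRingType) n (A Q : 'M[R]_n) (lam : 'I_n -> R) :=
  Q^T *m Q = 1%:M /\ A = Q *m diag_mx (\row_i lam i) *m Q^T.

Lemma char_poly_orthogonal_conj (R : comUnitRingType) n (Q B : 'M[R]_n) :
  Q^T *m Q = 1%:M -> char_poly (Q *m B *m Q^T) = char_poly B.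
Proof.
move=> QQ; have QQ' : Q *m Q^T = 1%:M by exact: mulmx1C.
pose P := map_mx polyC Q.
have PP : P *m P^T = 1%:M by rewrite /P map_trmx -map_mxM QQ' map_mx1.
have -> : char_poly (Q *m B *m Q^T) = \det (P *m char_poly_mx B *m P^T).
  rewrite /char_poly /char_poly_mx mulmxBr mulmxBl !map_mxM -map_trmx -/P.
  by rewrite mul_mx_scalar -scalemxAl PP scalemx1.
rewrite !det_mulmx mulrAC -det_mulmx PP det1 mul1r.
by [].
Qed.

Lemma eigenbasis_char_poly (R : comUnitRingType) n (A Q : 'M[R]_n) lam :
  eigenbasis A Q lam -> char_poly A = \prod_(i < n) ('X - (lam i)%:P).
Proof.
move=> [QQ ->]; rewrite char_poly_orthogonal_conj //.
rewrite char_poly_trig; last exact: diag_mx_is_trig.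
by apply: eq_bigr => i _; rewrite !mxE eqxx mulr1n.
Qed.

Lemma eigenbasis_perm (R : comPzRingType) n (A Q : 'M[R]_n) lam (s : 'S_n) :
  eigenbasis A Q lam -> eigenbasis A (col_perm s Q) (lam \o s).
Proof.
move=> [QQ AE]; rewrite /eigenbasis; split.
  apply/matrixP => i j.
  have /matrixP/(_ (s i) (s j)) := QQ; rewrite !mxE (inj_eq perm_inj) => <-.
  by apply: eq_bigr => k _; rewrite !mxE.
rewrite AE; apply/matrixP => i j; rewrite !mul_mx_diag !mxE.
rewrite (reindex_inj (@perm_inj _ s)) /=.
by apply: eq_bigr => k _; rewrite !mxE.
Qed.

Lemma symmetric_has_eigenbasis (R : rcfType) n (A : 'M[R]_n) :
  A^T = A -> exists Q lam, eigenbasis A Q lam.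
Proof.
move=> symA; have [Q [d [QQ AE]]] := symmetric_diagonalization symA.
exists Q, (d 0); split=> //; rewrite {1}AE; congr (_ *m diag_mx _ *m _).
by apply/rowP => i; rewrite mxE.
Qed.

(** The characteristic polynomial determines the eigenvalues with their
    multiplicities, so any list of its roots can be matched by permuting the
    columns of a given eigenbasis. *)
Lemma symmetric_eigenbasis (R : rcfType) n (A : 'M[R]_n) (lam : 'I_n -> R) :
  A^T = A -> char_poly A = \prod_(i < n) ('X - (lam i)%:P) ->
  exists Q, eigenbasis A Q lam.
Proof.
move=> symA charA; have [Q0 [d E0]] := symmetric_has_eigenbasis symA.
have := eigenbasis_char_poly E0; rewrite charA.
have prodE (f : 'I_n -> R) : \prod_(i < n) ('X - (f i)%:P)
    = \prod_(x <- [tuple f i | i < n]) ('X - x%:P).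
  by rewrite /= big_map big_enum.
rewrite !prodE => /prod_XsubC_eq /tuple_permP [s sE].
exists (col_perm s Q0).
have -> : lam = d \o s.
  apply/funext => i /=.
  have /(congr1 (fun t => nth 0 t i)) := sE.
  by rewrite -!tnth_nth !tnth_mktuple.
exact: eigenbasis_perm.
Qed.

Lemma symmetric_sorted_eigenvalues (R : rcfType) n (A : 'M[R]_n) : A^T = A ->
  exists lam : 'I_n -> R, char_poly A = \prod_(i < n) ('X - (lam i)%:P) /\
    (forall i j : 'I_n, (i <= j)%N -> lam i <= lam j).
Proof.
move=> symA; have [Q0 [d E0]] := symmetric_has_eigenbasis symA.
pose s := sort <=%O [tuple d i | i < n].
have ss : size s = n by rewrite size_sort size_tuple.
exists (fun i => nth 0 s i); split; last first.
  move=> i j ij; have := sort_le_sorted [tuple d i | i < n].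
  by move=> /(sorted_leq_nth le_trans lexx 0); apply; rewrite ?inE ?ss.
rewrite (eigenbasis_char_poly E0).
transitivity (\prod_(x <- s) ('X - x%:P)).
  have -> : \prod_(i < n) ('X - (d i)%:P)
      = \prod_(x <- [tuple d i | i < n]) ('X - x%:P).
    by rewrite /= big_map big_enum.
  by apply: perm_big; rewrite perm_sym perm_sort.
by rewrite (big_nth 0) ss big_mkord.
Qed.

(** * Quadratic forms and monotonicity of eigenvalues *)

Definition qform (R : pzRingType) n (A : 'M[R]_n) (x : 'cV[R]_n) : R :=
  (x^T *m A *m x) 0 0.

Section Rayleigh.
Variables (R : realFieldType) (n : nat) (A Q : 'M[R]_n) (lam : 'I_n -> R).
Hypothesis AQ : eigenbasis A Q lam.

Lemma qform_eigenbasis x : qform A x = \sum_i lam i * (Q^T *m x) i 0 ^+ 2.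
Proof.
have [_ ->] := AQ; rewrite /qform.
have -> : x^T *m (Q *m diag_mx (\row_i lam i) *m Q^T) *m x
   = (Q^T *m x)^T *m diag_mx (\row_i lam i) *m (Q^T *m x).
  by rewrite trmx_mul trmxK !mulmxA.
rewrite mul_mx_diag mxE; apply: eq_bigr => i _.
by rewrite ![in LHS]mxE mulrAC mulrC expr2; congr (_ * _); rewrite !mxE.
Qed.

Lemma sqnorm_eigenbasis x : qform 1%:M x = \sum_i (Q^T *m x) i 0 ^+ 2.
Proof.
have [/mulmx1C QQ _] := AQ; rewrite /qform mulmx1.
have -> : x^T *m x = (Q^T *m x)^T *m (Q^T *m x).
  by rewrite trmx_mul trmxK mulmxA -[_ *m Q *m _]mulmxA QQ mulmx1.
by rewrite mxE; apply: eq_bigr => i _; rewrite mxE expr2.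
Qed.

Lemma eigenvector_eigenbasis i : A *m col i Q = lam i *: col i Q.
Proof.
have [QQ AE] := AQ.
have AQE : A *m Q = Q *m diag_mx (\row_i lam i) by rewrite AE -!mulmxA QQ mulmx1.
apply/colP => j; transitivity ((A *m Q) j i).
  by rewrite !mxE; apply: eq_bigr => k _; rewrite mxE.
by rewrite AQE mul_mx_diag !mxE mulrC.
Qed.

Lemma orthonormal_eigenbasis i j : ((col i Q)^T *m col j Q) 0 0 = (i == j)%:R.
Proof.
have [/matrixP/(_ i j) QQ _] := AQ; rewrite mxE in QQ; rewrite !mxE in QQ *.
by rewrite -QQ; apply: eq_bigr => k _; rewrite !mxE.
Qed.

End Rayleigh.

(** Courant and Fischer: some nonzero vector [x] is orthogonal to the columns
    of [Q] before the [i]-th and to those of [Q'] after the [i]-th, since these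
    are only [n - 1] conditions. There the Rayleigh quotient of [A] is at least
    [lam i], and that of [A'] at most [lam' i]. *)
Lemma eigenvalue_le (R : realFieldType) n (A A' Q Q' : 'M[R]_n) lam lam' :
  eigenbasis A Q lam -> eigenbasis A' Q' lam' ->
  (forall i j : 'I_n, (i <= j)%N -> lam i <= lam j) ->
  (forall i j : 'I_n, (i <= j)%N -> lam' i <= lam' j) ->
  (forall x, qform A x <= qform A' x) ->
  forall i, lam i <= lam' i.
Proof.
move=> AQ AQ' lam_le lam'_le AA' i.
(* The [i]-th row imposes no condition: it is zero and makes [M] singular. *)
pose M : 'M[R]_n := \matrix_(j < n)
  if (j < i)%N then row j Q^T else if (i < j)%N then row j Q'^T else 0.
have : \det M^T = 0.
  by rewrite det_tr (expand_det_row _ i) big1 // => j _; rewrite mxE ltnn mxE mul0r.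
move=> /eqP/det0P [y y0 /(congr1 trmx)]; rewrite trmx_mul trmxK trmx0 => Mx.
set x := y^T in Mx.
have Mj (j : 'I_n) : (row j M *m x) 0 0 = 0 by rewrite -row_mul Mx !mxE.
have rowx (B : 'M[R]_n) j : (row j B *m x) 0 0 = (B *m x) j 0.
  by rewrite -row_mul mxE.
have lowx (j : 'I_n) : (j < i)%N -> (Q^T *m x) j 0 = 0.
  by move=> ji; rewrite -rowx -[RHS](Mj j) rowK ji.
have highx (j : 'I_n) : (i < j)%N -> (Q'^T *m x) j 0 = 0.
  by move=> ij; rewrite -rowx -[RHS](Mj j) rowK ltnNge (ltnW ij) ij.
have x2 : 0 < qform 1%:M x.
  have -> : qform 1%:M x = (y *m y^T) 0 0 by rewrite /qform mulmx1 trmxK.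
  by rewrite lt0r sqnorm_row_eq0 sqnorm_row_ge0 y0.
have lo : lam i * qform 1%:M x <= qform A x.
  rewrite (qform_eigenbasis AQ) (sqnorm_eigenbasis AQ) mulr_sumr.
  apply: ler_sum => j _; have [ji|ij] := ltnP j i.
    by rewrite lowx // expr0n !mulr0.
  by rewrite ler_wpM2r ?sqr_ge0 // lam_le.
have hi : qform A' x <= lam' i * qform 1%:M x.
  rewrite (qform_eigenbasis AQ') (sqnorm_eigenbasis AQ') mulr_sumr.
  apply: ler_sum => j _; have [ij|ji] := ltnP i j.
    by rewrite highx // expr0n !mulr0.
  by rewrite ler_wpM2r ?sqr_ge0 // lam'_le.
by rewrite -(ler_pM2r x2) (le_trans lo) // (le_trans (AA' x)).
Qed.

(** * The Laplacian of a power network *)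

Section Laplacian.
Variables (R : realType) (n : nat) (G : power_network R n).
Local Notation b := (susceptance G).
Local Notation L := (laplacian G).

Lemma susceptance_diag u : b u u = 0.
Proof. by apply: susceptance_eq0; rewrite edge_irrefl. Qed.

Lemma susceptance_ge0 u v : 0 <= b u v.
Proof.
have [uv|uv] := boolP (edge G u v); first exact/ltW/susceptance_gt0.
by rewrite susceptance_eq0.
Qed.

Lemma laplacian_sym : L^T = L.
Proof.
apply/matrixP => u v; rewrite !mxE eq_sym; case: eqP => [->//|_].
by rewrite susceptance_sym.
Qed.

Lemma laplacian_mulE (x : 'cV[R]_n) u :
  (L *m x) u 0 = \sum_v b u v * (x u 0 - x v 0).
Proof.
rewrite mxE (bigD1 u) //= mxE eqxx [RHS](bigD1 u) //= susceptance_diag mul0r.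
rewrite add0r mulr_suml -big_split /=; apply: eq_bigr => v vu.
by rewrite mxE eq_sym (negbTE vu) mulrBr mulNr.
Qed.

(** Each edge is counted from both of its ends, whence the factor [1 / 2]. *)
Lemma qform_laplacian (x : 'cV[R]_n) :
  qform L x = (\sum_u \sum_v b u v * (x u 0 - x v 0) ^+ 2) / 2.
Proof.
have E : qform L x = \sum_u \sum_v x u 0 * (b u v * (x u 0 - x v 0)).
  rewrite /qform -mulmxA mxE; apply: eq_bigr => u _.
  by rewrite laplacian_mulE mxE mulr_sumr.
suff -> : \sum_u \sum_v b u v * (x u 0 - x v 0) ^+ 2 = qform L x + qform L x.
  by field.
rewrite {1}E E [X in _ = _ + X]exchange_big -big_split /=.
apply: eq_bigr => u _; rewrite -big_split /=; apply: eq_bigr => v _.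
by rewrite [b v u]susceptance_sym; ring.
Qed.

Lemma qform_laplacian_ge0 x : 0 <= qform L x.
Proof.
rewrite qform_laplacian divr_ge0 // sumr_ge0 // => u _.
by rewrite sumr_ge0 // => v _; rewrite mulr_ge0 ?susceptance_ge0 ?sqr_ge0.
Qed.

(** The form is a sum of nonnegative terms, so its zeros agree across each
    edge, hence along paths, and the network is connected. *)
Lemma qform_laplacian_eq0 (x : 'cV[R]_n) :
  qform L x = 0 -> forall u v, x u 0 = x v 0.
Proof.
rewrite qform_laplacian => /eqP.
rewrite mulf_eq0 invr_eq0 pnatr_eq0 orbF psumr_eq0; last first.
  move=> u _; rewrite sumr_ge0 // => v _.
  by rewrite mulr_ge0 ?susceptance_ge0 ?sqr_ge0.
move=> /allP s0.
have edgex u v : edge G u v -> x u 0 = x v 0.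
  move=> uv; have := s0 u (mem_index_enum _).
  rewrite /= psumr_eq0; last first.
    by move=> w _; rewrite mulr_ge0 ?susceptance_ge0 ?sqr_ge0.
  move=> /allP/(_ v (mem_index_enum _)) /=.
  rewrite mulf_eq0 sqrf_eq0 subr_eq0 => /orP[|/eqP //].
  by rewrite gt_eqF // susceptance_gt0.
move=> u v; have /connectP [p pP ->] := edge_connected G u v.
by elim: p u pP => [//|w p IHp] u /= /andP[/edgex -> /IHp].
Qed.

Variables (Q : 'M[R]_n) (lam : 'I_n -> R).
Hypothesis LQ : eigenbasis L Q lam.

Lemma eigenbasis_qform_col i : qform L (col i Q) = lam i.
Proof.
rewrite /qform -mulmxA (eigenvector_eigenbasis LQ) -scalemxAr mxE.
by rewrite (orthonormal_eigenbasis LQ) eqxx mulr1.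
Qed.

Lemma laplacian_eigenvalue_ge0 i : 0 <= lam i.
Proof. by rewrite -eigenbasis_qform_col qform_laplacian_ge0. Qed.

Hypothesis lam_le : forall i j : 'I_n, (i <= j)%N -> lam i <= lam j.

(** The constant vector annihilates the form, which would be positive definite
    if the smallest eigenvalue were positive. *)
Lemma laplacian_first_eigenvalue (i : 'I_n) : i = 0%N :> nat -> lam i = 0.
Proof.
move=> i0; apply/eqP; rewrite eq_le laplacian_eigenvalue_ge0 andbT.
pose x : 'cV[R]_n := const_mx 1.
have x0 : qform L x = 0.
  rewrite qform_laplacian big1 ?mul0r // => u _.
  by rewrite big1 // => v _; rewrite !mxE subrr expr0n mulr0.
have x1 : 0 < qform 1%:M x.
  rewrite /qform mulmx1 mxE.
  under eq_bigr do rewrite !mxE mulr1.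
  by rewrite sumr_const card_ord ltr0n (leq_trans _ (ltn_ord i)).
rewrite -(ler_pM2r x1) mul0r -x0 (qform_eigenbasis LQ) (sqnorm_eigenbasis LQ).
rewrite mulr_sumr ler_sum // => j _.
by rewrite ler_wpM2r ?sqr_ge0 // lam_le // i0.
Qed.

(** Otherwise two orthonormal vectors would lie in the kernel, which consists
    of constant vectors. *)
Lemma laplacian_eigenvalue_gt0 (i : 'I_n) : (0 < i)%N -> 0 < lam i.
Proof.
move=> i0; rewrite lt0r laplacian_eigenvalue_ge0 andbT; apply/eqP => lami.
have n0 : (0 < n)%N by rewrite (leq_trans _ (ltn_ord i)).
pose o := Ordinal n0.
have lamo : lam o = 0 by exact: laplacian_first_eigenvalue.
have constQ j : lam j = 0 -> forall u, Q u j = Q o j.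
  rewrite -eigenbasis_qform_col => /qform_laplacian_eq0 cst u.
  by have := cst u o; rewrite !mxE.
have dotQ j k : lam j = 0 -> lam k = 0 -> Q o j * Q o k *+ n = (j == k)%:R.
  move=> j0 k0; rewrite -(orthonormal_eigenbasis LQ) mxE.
  rewrite (eq_bigr (fun=> Q o j * Q o k)) ?sumr_const ?card_ord // => u _.
  by rewrite !mxE (constQ _ j0) (constQ _ k0).
have := dotQ o i lamo lami; rewrite -val_eqE /= eq_sym eqn0Ngt i0 /= => /eqP.
rewrite mulrn_eq0 eqn0Ngt n0 /= mulf_eq0 => /orP[] /eqP z.
- have := dotQ o o lamo lamo; rewrite z mul0r mul0rn eqxx => /esym/eqP.
  by rewrite oner_eq0.
- have := dotQ i i lami lami; rewrite z mul0r mul0rn eqxx => /esym/eqP.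
  by rewrite oner_eq0.
Qed.

End Laplacian.

Lemma qform_laplacian_le (R : realType) n (G G' : power_network R n) :
  (forall u v, susceptance G u v <= susceptance G' u v) ->
  forall x, qform (laplacian G) x <= qform (laplacian G') x.
Proof.
move=> GG' x; rewrite !qform_laplacian ler_pM2r ?invr_gt0 //.
apply: ler_sum => u _; apply: ler_sum => v _.
by rewrite ler_wpM2r ?sqr_ge0.
Qed.

Lemma same_except_at_sym (R : realType) n (i j : 'I_n) (G G' : power_network R n) :
  same_except_at i j G G' -> same_except_at i j G' G.
Proof. by move=> GG' u v /GG' [-> ->]. Qed.

Lemma same_except_at_le (R : realType) n (i j : 'I_n) (G G' : power_network R n) :
  same_except_at i j G G' -> susceptance G i j <= susceptance G' i j ->
  forall u v, susceptance G u v <= susceptance G' u v.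
Proof.
move=> GG' ij u v; have [uv|/GG' [_ ->//]] := eqVneq [set u; v]%SET [set i; j]%SET.
have : (u == i) && (v == j) || (u == j) && (v == i).
  have /finset.setP uvij := uv.
  have := uvij u; have := uvij v; have := uvij i; have := uvij j.
  rewrite !finset.in_set2 !eqxx ?orbT /= ![i == _]eq_sym ![j == _]eq_sym.
  by case: (u == i); case: (u == j); case: (v == i); case: (v == j).
case/orP => /andP[/eqP -> /eqP ->] //.
by rewrite ![susceptance _ j i]susceptance_sym.
Qed.

Lemma adds_or_increases_le (R : realType) n (i j : 'I_n) (G G' : power_network R n) :
  adds_edge i j G G' \/ increases_susceptance i j G G' ->
  forall u v, susceptance G u v <= susceptance G' u v.
Proof.
case=> [[GG' ij ij']|[GG' _ _ /ltW]]; last exact: same_except_at_le.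
apply: same_except_at_le GG' _.
by rewrite susceptance_eq0 // susceptance_ge0.
Qed.

Lemma removes_or_decreases_le (R : realType) n (i j : 'I_n) (G G' : power_network R n) :
  removes_edge i j G G' \/ decreases_susceptance i j G G' ->
  forall u v, susceptance G' u v <= susceptance G u v.
Proof.
case=> [[GG' ij ij']|[GG' ij ij' lt]]; apply: adds_or_increases_le.
- by left; split; [exact: same_except_at_sym GG'|exact: ij'|exact: ij].
- by right; split; [exact: same_except_at_sym GG'|exact: ij'|exact: ij|].
Qed.

(** * Exponential generating functions *)

Definition egf (R : realType) (c : R^nat) (t : R) : R :=
  limn (pseries (fun m => c m / m`!%:R) t).

(** The exponent [m.+1] lets [C] absorb the size of [c 0]. *)
Definition geometric_growth (R : realType) (c : R^nat) :=
  exists C, forall m, `|c m| <= C ^+ m.+1.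

Section Egf.
Variable R : realType.
Implicit Types (c : R^nat) (t : R).

Lemma geometric_growth_shift c :
  geometric_growth c -> geometric_growth (fun m => c m.+1).
Proof.
move=> [C cC]; have C0 : 0 <= C by rewrite -[C]expr1 (le_trans _ (cC 0)).
exists (Num.max C 1 ^+ 2) => m; rewrite (le_trans (cC _)) //.
have M1 : 1 <= Num.max C 1 by rewrite le_max lexx orbT.
apply: (@le_trans _ _ (Num.max C 1 ^+ m.+2)).
  by rewrite lerXn2r ?nnegrE ?le_max ?C0 ?lexx.
rewrite -exprM; apply: ler_weXn2l => //.
by rewrite mul2n -addnn addnS !ltnS leq_addr.
Qed.

Lemma is_cvg_egf c t : geometric_growth c ->
  cvgn (pseries (fun m => c m / m`!%:R) t).
Proof.
move=> [C cC]; have C0 : 0 <= C by rewrite -[C]expr1 (le_trans _ (cC 0)).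
apply: normed_cvg; apply: (@series_le_cvg _ _ (C *: exp_coeff (C * `|t|))).
- by move=> m; rewrite normr_ge0.
- by move=> m; rewrite /= mulr_ge0 // divr_ge0 ?exprn_ge0 ?mulr_ge0.
- move=> m; rewrite [leRHS](_ : _ = C ^+ m.+1 / m`!%:R * `|t| ^+ m).
  rewrite /= !normrM normfV normr_nat normrX.
    by rewrite ler_wpM2r ?exprn_ge0 // ler_wpM2r ?invr_ge0 ?ler0n.
  rewrite -[LHS]/(C * ((C * `|t|) ^+ m / m`!%:R)) exprMn exprS.
  by rewrite !mulrA mulrAC.
- exact/is_cvg_seriesZ/is_cvg_series_exp_coeff.
Qed.

(** Differentiation of an exponential generating function shifts its
    coefficients, so a linear recurrence becomes a linear differential equation. *)
Lemma is_derive_egf c t : geometric_growth c ->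
  is_derive t 1 (egf c) (egf (fun m => c m.+1) t).
Proof.
move=> gc; have diffsE c' : pseries_diffs (fun m => c' m / m`!%:R : R)
    = (fun m => c' m.+1 / m`!%:R).
  apply/funext => m; rewrite /pseries_diffs factS natrM.
  by rewrite invfM mulrCA mulVKf ?pnatr_eq0.
rewrite /egf -diffsE; apply: (@pseries_snd_diffs _ _ (`|t| + 1)).
- exact: is_cvg_egf.
- rewrite diffsE; apply: (@is_cvg_egf (fun m => c m.+1)).
  exact: geometric_growth_shift.
- rewrite diffsE (diffsE (fun m => c m.+1)).
  apply: (@is_cvg_egf (fun m => c m.+2)).
  exact/(@geometric_growth_shift (fun m => c m.+1))/geometric_growth_shift.
- by rewrite [ltRHS]ger0_norm ?ltrDl // addr_ge0.
Qed.

Lemma egf0 c : egf c 0 = c 0%N.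
Proof.
apply: lim_near_cst => //; near=> m.
rewrite /pseries /series /= -[m]prednK; last by near: m; exists 1%N.
rewrite big_nat_recl //= expr0 mulr1 divr1 big1 ?addr0 // => i _.
by rewrite exprS mul0r mulr0.
Unshelve. all: by end_near. Qed.

End Egf.

Lemma egf_lin3 (R : realType) (u v w : R^nat) (a b c : R) t :
  geometric_growth u -> geometric_growth v -> geometric_growth w ->
  egf (fun m => a * u m + b * v m + c * w m) t
  = a * egf u t + b * egf v t + c * egf w t.
Proof.
move=> gu gv gw; rewrite /egf /pseries.
pose s (u : R^nat) : R^nat := fun m => u m / m`!%:R * t ^+ m.
have -> : (fun m => (a * u m + b * v m + c * w m) / m`!%:R * t ^+ m)
    = a *: s u + b *: s v + c *: s w.
  apply/funext => m.
  rewrite -[RHS]/(a * (u m / m`!%:R * t ^+ m) + b * (v m / m`!%:R * t ^+ m)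
    + c * (w m / m`!%:R * t ^+ m)); ring.
have cvgs c' : geometric_growth c' -> cvgn (series (s c')) by exact: is_cvg_egf.
have cvgZ x c' : geometric_growth c' -> cvgn (series (x *: s c')).
  by move=> gc; exact/is_cvg_seriesZ/cvgs.
rewrite lim_seriesD; [|by apply: is_cvg_seriesD; exact: cvgZ|exact: cvgZ].
rewrite lim_seriesD; [|exact: cvgZ|exact: cvgZ].
by rewrite !lim_seriesZ //; exact: cvgs.
Qed.

(** * Energy integrals by Lyapunov's method *)

(** The function [W s * expR (c * s)] is nonincreasing. *)
Lemma exponential_decay (R : realType) (W W' : R -> R) (c : R) :
  (forall t, is_derive t (1 : R) W (W' t)) -> (forall t, W' t <= - c * W t) ->
  forall t, 0 <= t -> W t <= W 0 * expR (- (c * t)).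
Proof.
move=> dW W'le t t0; pose g s := W s * expR (c * s).
have dg s : is_derive s (1 : R) g ((W' s + c * W s) * expR (c * s)).
  have dexp : is_derive s (1 : R) (fun s => expR (c * s)) (c * expR (c * s)).
    have dc : is_derive s (1 : R) (fun s : R => c * s) c.
      have -> : (fun s : R => c * s) = c \*: id by [].
      by apply: is_derive_eq; rewrite -[RHS]mulr1.
    have -> : (fun s => expR (c * s)) = expR \o (fun s => c * s) by [].
    by apply: is_derive_eq; rewrite mulrC.
  have -> : g = W * (fun s => expR (c * s)) by [].
  apply: is_derive_eq; rewrite /GRing.scale /=; ring.
have g_le : g t <= g 0.
  apply: (@ler0_derive1_le_cc _ g 0 t); rewrite ?in_itv /= ?lexx ?t0 //.
  - move=> s _; rewrite derive1E (@derive_val _ _ _ _ _ _ _ (dg s)).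
    by rewrite mulr_le0_ge0 ?expR_ge0 // -lerBrDr sub0r -mulNr.
  - apply: derivable_within_continuous => s _; by case: (dg s).
rewrite expRN -ler_pdivrMr ?invr_gt0 ?expR_gt0 // invrK.
by rewrite (le_trans g_le) // /g mulr0 expR0 mulr1.
Qed.

(** [V] is a primitive of [- f], so the integral is [V 0] minus the limit of [V];
    the second function [W] serves only to show that this limit is [0]. *)
Lemma integral_by_lyapunov (R : realType) (f V W W' : R -> R) (c M : R) :
  0 < c -> 0 <= M -> continuous f -> (forall t, 0 <= f t) ->
  (forall t, is_derive t (1 : R) V (- f t)) ->
  (forall t, is_derive t (1 : R) W (W' t)) -> (forall t, W' t <= - c * W t) ->
  (forall t, `|V t| <= M * W t) ->
  (\int[lebesgue_measure]_(t in `[0%R, +oo[) (f t)%:E = (V 0)%:E)%E.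
Proof.
move=> c0 M0 cf f0 dV dW W'le VW.
have V0 : V t @[t --> +oo] --> 0.
  have ub t : 0 <= t -> `|V t| <= M * W 0 * expR (- (c * t)).
    move=> t0; rewrite (le_trans (VW t)) // -mulrA ler_wpM2l //.
    exact: exponential_decay dW W'le _ t0.
  have e0 : M * W 0 * expR (- (c * t)) @[t --> +oo] --> 0.
    rewrite -[X in _ --> X](mulr0 (M * W 0)); apply: cvgMl_tmp.
    have := @cvgr_expR R; apply: cvg_comp.
    by apply: gt0_cvgMry.
  apply/norm_cvg0P; apply: (squeeze_cvgr _ (cvg_cst 0) e0).
  by near=> t; rewrite normr_ge0 ub.
have cV : continuous V.
  by move=> t; apply: differentiable_continuous; apply/derivable1_diffP; case: (dV t).
rewrite (@ge0_continuous_FTC2y _ f (- V) 0 0).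
- by rewrite sub0e -EFinN opprK.
- by move=> t _; exact: f0.
- by apply: continuous_subspaceT.
- by rewrite -oppr0; apply: cvgN.
- by move=> t _; apply: derivableN; case: (dV t).
- by apply: cvg_at_right_filter; apply: cvgN; exact: cV.
- move=> t _; rewrite derive1E deriveN; last by case: (dV t).
  by rewrite (@derive_val _ _ _ _ _ _ _ (dV t)) opprK.
Unshelve. all: by end_near. Qed.

(** * The scalar mode of a positive eigenvalue *)

Definition qform3 (R : pzRingType) (a b c d e f x y z : R) : R :=
  a * (x * x) + b * (y * y) + c * (z * z) + d * (x * y) + e * (x * z) + f * (y * z).

Lemma is_derive_qform3 (R : realType) (a b c d e f : R) (x y z : R -> R)
    (t x' y' z' : R) :
  is_derive t (1 : R) x x' -> is_derive t (1 : R) y y' ->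
  is_derive t (1 : R) z z' ->
  is_derive t (1 : R) (fun s => qform3 a b c d e f (x s) (y s) (z s))
    (qform3 a b c d e f (x t + x') (y t + y') (z t + z')
     - qform3 a b c d e f (x t) (y t) (z t) - qform3 a b c d e f x' y' z').
Proof.
move=> dx dy dz.
have -> : (fun s => qform3 a b c d e f (x s) (y s) (z s)) =
  a \*: (x * x) + b \*: (y * y) + c \*: (z * z) + d \*: (x * y)
  + e \*: (x * z) + f \*: (y * z) by [].
have prod (w : R) (u : R -> R) (u' : R) (v : R -> R) (v' : R) :
    is_derive t (1 : R) u u' -> is_derive t (1 : R) v v' ->
    is_derive t (1 : R) (w \*: (u * v)) (w * (u t * v' + v t * u')).
  by move=> du dv; exact: is_deriveZ (is_deriveM du dv).
apply: is_derive_eq (is_deriveD (is_deriveD (is_deriveD (is_deriveD (is_deriveD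
  (prod a _ _ _ _ dx dx) (prod b _ _ _ _ dy dy)) (prod c _ _ _ _ dz dz))
  (prod d _ _ _ _ dx dy)) (prod e _ _ _ _ dx dz)) (prod f _ _ _ _ dy dz)) _.
by rewrite /qform3; ring.
Qed.

(** Equivalence of norms: a positive definite diagonal form bounds any form. *)
Lemma qform3_le_diag (R : realFieldType) (a b c d e f p q r x y z : R) :
  0 < p -> 0 < q -> 0 < r ->
  `|qform3 a b c d e f x y z| <=
  (`|a| + `|b| + `|c| + `|d| + `|e| + `|f|) * (p^-1 + q^-1 + r^-1)
  * qform3 p q r 0 0 0 x y z.
Proof.
move=> p0 q0 r0; set s := x * x + y * y + z * z.
have x2 : 0 <= x * x by rewrite -expr2 sqr_ge0.
have y2 : 0 <= y * y by rewrite -expr2 sqr_ge0.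
have z2 : 0 <= z * z by rewrite -expr2 sqr_ge0.
have prod u v : u * u + v * v <= s -> `|u * v| <= s.
  move=> uv; have := sqr_ge0 (u - v); have := sqr_ge0 (u + v).
  rewrite sqrrD sqrrB !expr2 ler_norml => h1 h2; apply/andP; split; lra.
have [xx yy zz] : [/\ `|x * x| <= s, `|y * y| <= s & `|z * z| <= s].
  by rewrite !ger0_norm // /s; split; lra.
have [xy xz yz] : [/\ `|x * y| <= s, `|x * z| <= s & `|y * z| <= s].
  by split; apply: prod; rewrite /s; lra.
apply: (@le_trans _ _ ((`|a| + `|b| + `|c| + `|d| + `|e| + `|f|) * s)).
  rewrite /qform3 !mulrDl.
  do 5! (apply: le_trans (ler_normD _ _) _; apply: lerD;
    last by rewrite normrM ler_wpM2l).
  by rewrite normrM ler_wpM2l.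
rewrite -mulrA ler_wpM2l ?addr_ge0 //.
set m := p^-1 + q^-1 + r^-1.
have [ip iq ir] : [/\ 0 < p^-1, 0 < q^-1 & 0 < r^-1] by rewrite !invr_gt0.
have [mp mq mr] : [/\ 1 <= m * p, 1 <= m * q & 1 <= m * r].
  split; rewrite -ler_pdivrMr // div1r /m; lra.
have -> : m * qform3 p q r 0 0 0 x y z
    = m * p * (x * x) + m * q * (y * y) + m * r * (z * z) by rewrite /qform3; ring.
by rewrite /s; apply: lerD; [apply: lerD|]; rewrite ler_peMl.
Qed.

(** The energy of the mode plus the cross term [d * tau * x * y], without which
    the derivative would be independent of [x] and only negative semidefinite. *)
Definition lyapunov_form (R : fieldType) (K tau q d x y z : R) : R :=
  qform3 (K / 2) (tau / 2) (q / 2) (d * tau) 0 0 x y z.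

(** The left-hand side of the first inequality is the derivative of the form
    along the motion. For small [d] the two mixed terms are absorbed in
    the squares by completing squares. *)
Lemma lyapunov_coefficients (R : realFieldType) (K g tau q : R) :
  0 < K -> 0 < g -> 0 < tau -> 0 < q ->
  exists d c : R, 0 < c /\ forall X Y Z,
    - (Y * Y) - g * (Z * Z) + d * (tau * (Y * Y) - K * (X * X) - X * Y + X * Z)
      <= - c * lyapunov_form K tau q d X Y Z /\
    qform3 (K / 4) (tau / 4) (q / 2) 0 0 0 X Y Z <= lyapunov_form K tau q d X Y Z.
Proof.
move=> K0 g0 tau_gt0 q_gt0.
have [d [d0 d1 d2 d3 d4]] : exists d, [/\ 0 < d, d * tau <= K / 2, d <= 1 / 2,
    d * (tau + K^-1) <= 1 / 2 & d * K^-1 <= g / 2].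
  have s0 : 0 < tau + K^-1 by rewrite addr_gt0 ?invr_gt0.
  exists (Num.min (Num.min (K / 2 / tau) (1 / 2))
     (Num.min (1 / 2 / (tau + K^-1)) (g / 2 * K))); split.
  - by rewrite !lt_min !divr_gt0 ?mulr_gt0 ?divr_gt0.
  - by rewrite -ler_pdivlMr // !ge_min lexx.
  - by rewrite !ge_min lexx orbT.
  - by rewrite -ler_pdivlMr // !ge_min lexx !orbT.
  - by rewrite -ler_pdivlMr ?invr_gt0 // invrK !ge_min lexx !orbT.
have [c [c0 c1 c2 c3]] : exists c, [/\ 0 < c, c * (3 / 4 * K) <= d * K / 2,
    c * (3 / 4 * tau) <= 1 / 2 & c * (q / 2) <= g / 2].
  exists (Num.min (d * K / 2 / (3 / 4 * K))
    (Num.min (1 / 2 / (3 / 4 * tau)) (g / 2 / (q / 2)))).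
  have [K1 t1 q1] : [/\ 0 < 3 / 4 * K, 0 < 3 / 4 * tau & 0 < q / 2].
    by rewrite !(mulr_gt0, divr_gt0).
  split.
  - by rewrite !lt_min !divr_gt0 ?mulr_gt0.
  - by rewrite -ler_pdivlMr // !ge_min lexx.
  - by rewrite -ler_pdivlMr // !ge_min lexx !orbT.
  - by rewrite -ler_pdivlMr // !ge_min lexx !orbT.
have iK : K * K^-1 = 1 by rewrite mulfV // gt_eqF.
have sq0 (u : R) : 0 <= u * u by rewrite -expr2 sqr_ge0.
have wsq (u v w : R) : u <= v -> u * (w * w) <= v * (w * w).
  by move=> uv; rewrite ler_wpM2r ?sq0.
have cross X Y : `|d * tau * (X * Y)| <= K / 4 * (X * X) + tau / 4 * (Y * Y).
  have P0 : 0 <= d * tau by rewrite mulr_ge0 ?ltW.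
  have d5 : d * tau <= tau / 2 by rewrite [leRHS]mulrC ler_pM2r // -div1r.
  have := wsq _ _ X d1; have := wsq _ _ Y d5.
  have := mulr_ge0 P0 (sq0 (X + Y)); have := mulr_ge0 P0 (sq0 (X - Y)).
  rewrite ler_norml => h1 h2 h3 h4; apply/andP; split; lra.
exists d, c; split=> // X Y Z.
have := cross X Y; rewrite ler_norml => /andP[lo hi]; split; last first.
  by rewrite /lyapunov_form /qform3; lra.
have dK : 0 <= d * K^-1 by rewrite mulr_ge0 ?invr_ge0 ?ltW.
have h1 : 0 <= d * (K / 4 * (X * X) + X * Y + K^-1 * (Y * Y)).
  have := mulr_ge0 dK (sq0 (K * X / 2 + Y)).
  by congr (0 <= _); field; rewrite gt_eqF.
have h2 : 0 <= d * (K / 4 * (X * X) - X * Z + K^-1 * (Z * Z)).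
  have := mulr_ge0 dK (sq0 (K * X / 2 - Z)).
  by congr (0 <= _); field; rewrite gt_eqF.
have := ler_wpM2l (ltW c0) hi.
have := wsq _ _ Y d3; have := wsq _ _ Z d4.
have := wsq _ _ X c1; have := wsq _ _ Y c2; have := wsq _ _ Z c3.
rewrite /lyapunov_form /qform3 => *; lra.
Qed.

Section Mode.
Variables (R : realType) (k tau q gamma l : R).
Hypotheses (k_gt0 : 0 < k) (tau_gt0 : 0 < tau) (q_gt0 : 0 < q)
  (gamma_gt0 : 0 < gamma) (l_gt0 : 0 < l).
Variables x y z : R -> R.
Hypothesis dx : forall t, is_derive t (1 : R) x (y t).
Hypothesis dy : forall t,
  is_derive t (1 : R) y (- (k / tau) * (l * x t) - tau^-1 * y t + tau^-1 * z t).
Hypothesis dz : forall t,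
  is_derive t (1 : R) z (- q^-1 * y t - gamma / q * (l * z t)).

Lemma mode_lyapunov : exists (d c : R) (W' : R -> R),
  [/\ 0 < c,
    forall t, is_derive t (1 : R)
      (fun s => lyapunov_form (k * l) tau q d (x s) (y s) (z s)) (W' t),
    forall t, W' t <= - c * lyapunov_form (k * l) tau q d (x t) (y t) (z t)
  & forall t, qform3 (k * l / 4) (tau / 4) (q / 2) 0 0 0 (x t) (y t) (z t)
    <= lyapunov_form (k * l) tau q d (x t) (y t) (z t)].
Proof.
have K0 : 0 < k * l by rewrite mulr_gt0.
have g0 : 0 < gamma * l by rewrite mulr_gt0.
have [d [c [c0 dcP]]] := lyapunov_coefficients K0 g0 tau_gt0 q_gt0.
exists d, c, (fun t => - (y t * y t) - gamma * l * (z t * z t)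
  + d * (tau * (y t * y t) - k * l * (x t * x t) - x t * y t + x t * z t)).
split; first exact: c0.
- move=> t; apply: is_derive_eq (is_derive_qform3 _ _ _ _ _ _ (dx t) (dy t) (dz t)) _.
  by rewrite /qform3; field; rewrite !gt_eqF.
- by move=> t; have [+ _] := dcP (x t) (y t) (z t).
- by move=> t; have [_ +] := dcP (x t) (y t) (z t).
Qed.

(** The last diagonal entry of the observability Gramian of the mode for the
    output [x]: the energy of [x] when the motion starts at [(0, 0, 1)]. *)
Definition theta_energy : R :=
  q ^+ 2 * (tau * (gamma * l) + q) /
   (2 * (k * l) * (gamma * l) *
     (q * (gamma * l) + k * l * q ^+ 2 + q + tau * (gamma * l) ^+ 2 + tau * (gamma * l))).

(** The Lyapunov equation for the output [x], solved by comparing the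
    coefficients of the six monomials. The denominator [D] is the Hurwitz
    determinant [a1 * a2 - a0 * a3] of the characteristic polynomial of the mode
    cleared of denominators. *)
Lemma mode_gramian : exists a b d e f,
  forall t, is_derive t (1 : R) (fun s => qform3 a b theta_energy d e f (x s) (y s) (z s))
    (- (x t * x t)).
Proof.
have K0 : 0 < k * l by rewrite mulr_gt0.
have g0 : 0 < gamma * l by rewrite mulr_gt0.
pose K := k * l; pose g := gamma * l.
pose D := q * g + K * q ^+ 2 + q + tau * g ^+ 2 + tau * g.
have D0 : 0 < D by rewrite !addr_gt0 // ?mulr_gt0 ?exprn_gt0.
pose c := theta_energy.
pose f := c * g * tau / q.
pose d := tau / (2 * K).
pose b := tau * (d - f / q).
pose e := (q / g) * ((2 * K)^-1 - f * K / tau).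
pose a := b * K / tau + d / tau + e / q.
exists a, b, (2 * d), (2 * e), (2 * f) => t.
apply: is_derive_eq (is_derive_qform3 _ _ _ _ _ _ (dx t) (dy t) (dz t)) _.
rewrite /qform3 /a /e /b /d /f /c /theta_energy /K /g.
field; rewrite !gt_eqF //=.
Qed.
Lemma integral_theta_sqr : x 0 = 0 -> y 0 = 0 -> z 0 = 1 ->
  (\int[lebesgue_measure]_(t in `[0%R, +oo[) (x t * x t)%:E = theta_energy%:E)%E.
Proof.
move=> x0 y0 z0.
have [a [b [d [e [f dV]]]]] := mode_gramian.
have [dl [c [W' [c0 dW W'le Wge]]]] := mode_lyapunov.
have [K4 t4 q2] : [/\ 0 < k * l / 4, 0 < tau / 4 & 0 < q / 2].
  by rewrite !(divr_gt0, mulr_gt0).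
pose V s := qform3 a b theta_energy d e f (x s) (y s) (z s).
have -> : theta_energy = V 0 by rewrite /V /qform3 x0 y0 z0; ring.
have M0 : 0 <= (`|a| + `|b| + `|theta_energy| + `|d| + `|e| + `|f|) *
    ((k * l / 4)^-1 + (tau / 4)^-1 + (q / 2)^-1).
  by rewrite mulr_ge0 // !addr_ge0 // invr_ge0 ltW.
apply: (integral_by_lyapunov c0 M0 _ _ dV dW W'le).
- have cx : continuous x.
    by move=> t; apply: differentiable_continuous; apply/derivable1_diffP; case: (dx t).
  by move=> t; apply: cvgM; exact: cx.
- by move=> t; rewrite -expr2 sqr_ge0.
- move=> t; apply: le_trans (qform3_le_diag _ _ _ _ _ _ _ _ _ K4 t4 q2) _.
  by rewrite ler_wpM2l ?Wge.
Qed.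

End Mode.

(** * Modal form of the impulse response *)

Section ModeSeries.
Variables (R : realType) (k tau q gamma l : R).

Definition mode_step (v : R * R * R) : R * R * R :=
  let: (x, y, z) := v in
  (y, - (k / tau) * (l * x) - tau^-1 * y + tau^-1 * z,
   - q^-1 * y - gamma / q * (l * z)).

(** The derivatives at time [0] of the impulse response [(theta, omega, Omega)]
    of a mode, up to the noise gain [eps / q]. *)
Definition mode_coef (m : nat) : R * R * R := iter m mode_step (0, 0, 1).

Definition mode_theta (t : R) : R := egf (fun m => (mode_coef m).1.1) t.
Definition mode_omega (t : R) : R := egf (fun m => (mode_coef m).1.2) t.
Definition mode_Omega (t : R) : R := egf (fun m => (mode_coef m).2) t.

Lemma mode_coefS m : mode_coef m.+1 =
  ((mode_coef m).1.2,
   - (k / tau) * (l * (mode_coef m).1.1) - tau^-1 * (mode_coef m).1.2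
     + tau^-1 * (mode_coef m).2,
   - q^-1 * (mode_coef m).1.2 - gamma / q * (l * (mode_coef m).2)).
Proof. by rewrite {1}/mode_coef iterS -/(mode_coef m); case: (mode_coef m) => [[]]. Qed.

Lemma mode_coef_growth : [/\ geometric_growth (fun m => (mode_coef m).1.1),
  geometric_growth (fun m => (mode_coef m).1.2) &
  geometric_growth (fun m => (mode_coef m).2)].
Proof.
pose C := 1 + `|k / tau * l| + `|tau^-1| + `|tau^-1| + `|q^-1| + `|gamma / q * l|.
have C1 : 1 <= C by rewrite /C -!addrA lerDl !addr_ge0.
suff H m : [/\ `|(mode_coef m).1.1| <= C ^+ m.+1,
    `|(mode_coef m).1.2| <= C ^+ m.+1 & `|(mode_coef m).2| <= C ^+ m.+1].
  by split; exists C => m; have [] := H m.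
elim: m => [|m [IH1 IH2 IH3]].
  by rewrite /= !normr0 normr1 expr1 C1 (le_trans ler01).
rewrite mode_coefS /= exprS; set D := C ^+ m.+1 in IH1 IH2 IH3 *.
have D0 : 0 <= D by rewrite (le_trans _ IH1).
have term (a u : R) : `|u| <= D -> `|a * u| <= `|a| * D.
  by move=> uD; rewrite normrM ler_wpM2l.
have CD : C * D = D + `|k / tau * l| * D + `|tau^-1| * D + `|tau^-1| * D
  + `|q^-1| * D + `|gamma / q * l| * D by rewrite /C; ring.
have [p1 p2 p3 p4] : [/\ 0 <= `|k / tau * l| * D, 0 <= `|tau^-1| * D,
  0 <= `|q^-1| * D & 0 <= `|gamma / q * l| * D] by rewrite !mulr_ge0.
have t1 := term (k / tau * l) _ IH1; have t2 := term (tau^-1) _ IH2.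
have t3 := term (tau^-1) _ IH3; have t4 := term (q^-1) _ IH2.
have t5 := term (gamma / q * l) _ IH3.
rewrite CD; split; first lra.
- rewrite mulNr mulrA (le_trans (ler_normD _ _)) //.
  have := ler_normD (- (k / tau * l * (mode_coef m).1.1))
    (- (tau^-1 * (mode_coef m).1.2)).
  rewrite !normrN; lra.
- rewrite mulNr mulrA (le_trans (ler_normB _ _)) // normrN; lra.
Qed.

Lemma is_derive_mode t : [/\
  is_derive t (1 : R) mode_theta (mode_omega t),
  is_derive t (1 : R) mode_omega (- (k / tau) * (l * mode_theta t)
    - tau^-1 * mode_omega t + tau^-1 * mode_Omega t) &
  is_derive t (1 : R) mode_Omega
    (- q^-1 * mode_omega t - gamma / q * (l * mode_Omega t))].
Proof.
have [g1 g2 g3] := mode_coef_growth; split.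
- apply: is_derive_eq (is_derive_egf _ g1) _.
  by congr (egf _ _); apply/funext => m; rewrite mode_coefS.
- apply: is_derive_eq (is_derive_egf _ g2) _.
  transitivity (- (k / tau * l) * mode_theta t + - tau^-1 * mode_omega t
      + tau^-1 * mode_Omega t); last by ring.
  rewrite -[RHS](egf_lin3 _ _ _ _ g1 g2 g3).
  by congr (egf _ _); apply/funext => m; rewrite mode_coefS /=; ring.
- apply: is_derive_eq (is_derive_egf _ g3) _.
  transitivity (0 * mode_theta t + - q^-1 * mode_omega t
      + - (gamma / q * l) * mode_Omega t); last by ring.
  rewrite -[RHS](egf_lin3 _ _ _ _ g1 g2 g3).
  by congr (egf _ _); apply/funext => m; rewrite mode_coefS /=; ring.
Qed.

Lemma mode_initial_state : [/\ mode_theta 0 = 0, mode_omega 0 = 0 & mode_Omega 0 = 1].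
Proof. by rewrite /mode_theta /mode_omega /mode_Omega !egf0. Qed.

Lemma continuous_mode_theta : continuous mode_theta.
Proof.
move=> t; apply: differentiable_continuous; apply/derivable1_diffP.
by have [[]] := is_derive_mode t.
Qed.

Lemma cvg_mode_theta t :
  series (fun m => t ^+ m * (mode_coef m).1.1 / m`!%:R) @ \oo --> mode_theta t.
Proof.
have [g1 _ _] := mode_coef_growth; have := is_cvg_egf (t := t) g1.
rewrite /mode_theta /egf /pseries.
rewrite (_ : (fun m => t ^+ m * (mode_coef m).1.1 / m`!%:R)
  = (fun m => (mode_coef m).1.1 / m`!%:R * t ^+ m)) //.
by apply/funext => m; rewrite -mulrA mulrC.
Qed.

End ModeSeries.

Section ImpulseResponse.
Variables (R : realType) (n : nat) (k tau q gamma : R) (G : power_network R n).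
Variables (Q : 'M[R]_n) (lam : 'I_n -> R).
Hypothesis LQ : eigenbasis (laplacian G) Q lam.
Local Notation coef i m := (mode_coef k tau q gamma (lam i) m).
Local Notation A := (dapi_state_mx k tau q gamma G).

(** The state matrix acts on the span of the copies of an eigenvector in the
    three blocks as the scalar mode of its eigenvalue. *)
Lemma dapi_state_exp (t : R) m :
  (t *: A) ^+ m *m col_mx 0 (col_mx 0 Q) =
  t ^+ m *: col_mx (Q *m diag_mx (\row_i (coef i m).1.1))
    (col_mx (Q *m diag_mx (\row_i (coef i m).1.2))
            (Q *m diag_mx (\row_i (coef i m).2))).
Proof.
have [QQ LE] := LQ.
have LQE (d : 'I_n -> R) : laplacian G *m (Q *m diag_mx (\row_i d i))
    = Q *m diag_mx (\row_i (lam i * d i)).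
  rewrite {1}LE -!mulmxA [Q^T *m _]mulmxA QQ mul1mx mulmx_diag.
  by congr (_ *m diag_mx _); apply/rowP => i; rewrite !mxE.
elim: m => [|m IHm].
  have rowE (c : R) : \row_(i < n) c = const_mx c by apply/rowP => i; rewrite !mxE.
  rewrite !expr0 scale1r mul1mx /= !rowE !diag_const_mx.
  by rewrite !raddf0 ?mulmx0 mulmx1.
rewrite exprS -mulmxE -mulmxA IHm -scalemxAr -scalemxAl scalerA exprSr.
congr (_ *: _); rewrite /dapi_state_mx.
rewrite !mul_block_col mul_row_col mul_col_mx add_col_mx.
rewrite !mul0mx mul1mx !add0r !addr0 !mul_scalar_mx -!scalemxAl !LQE.
congr col_mx; first by apply/matrixP => i j; rewrite !mul_mx_diag !mxE mode_coefS.
by congr col_mx; apply/matrixP => i j; rewrite !mul_mx_diag !mxE mode_coefS /=; ring.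
Qed.

Local Notation theta i t := (mode_theta k tau q gamma (lam i) t).

(** The exponential series is summed entrywise in the block that carries initial
    integral states to phase angles, where [dapi_state_exp] gives every power. *)
Lemma dapi_exp_theta_Omega (t : R) (a b : 'I_n) :
  mxexp (t *: A) (lshift (n + n) a) (rshift n (rshift n b))
  = (Q *m diag_mx (\row_i theta i t) *m Q^T) a b.
Proof.
have [/mulmx1C QQ _] := LQ; rewrite mxE.
have powE m : ((t *: A) ^+ m) (lshift (n + n) a) (rshift n (rshift n b))
    = \sum_i Q a i * Q b i * (t ^+ m * (coef i m).1.1).
  transitivity (usubmx ((t *: A) ^+ m *m col_mx 0 (col_mx 0 Q) *m Q^T) a b).
    rewrite -mulmxA !mul_col_mx !mul0mx QQ.
    rewrite mxE mxE (bigD1 (rshift n (rshift n b))) //= !col_mxEd !mxE eqxx mulr1.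
    rewrite big1 ?addr0 // => i ib.
    case: (split_ordP i) ib => j -> ; first by rewrite col_mxEu mxE mulr0.
    rewrite col_mxEd; case: (split_ordP j) => j' ->; first by rewrite col_mxEu mxE mulr0.
    rewrite col_mxEd mxE !eq_rshift => /negbTE ->; exact: mulr0.
  rewrite dapi_state_exp -scalemxAl mul_col_mx scale_col_mx col_mxKu.
  rewrite mxE mxE mulr_sumr; apply: eq_bigr => i _.
  by rewrite mul_mx_diag !mxE; ring.
transitivity (\sum_i Q a i * Q b i * theta i t); last first.
  rewrite mul_mx_diag mxE; apply: eq_bigr => i _.
  by rewrite !mxE; ring.
apply: cvg_lim => //.
rewrite (_ : series _ = (fun N => \sum_i Q a i * Q b i *
    series (fun m => t ^+ m * (coef i m).1.1 / m`!%:R) N)); last first.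
  apply/funext => N; rewrite /series /=.
  under eq_bigr do rewrite powE mulr_suml.
  rewrite exchange_big /=; apply: eq_bigr => i _.
  by rewrite mulr_sumr; apply: eq_bigr => m _; ring.
apply: cvg_big => [|i _]; first exact: add_continuous.
by apply: cvgMl_tmp; exact: cvg_mode_theta.
Qed.

End ImpulseResponse.

(** The square root is picked by choice; the eigenbasis shows that there is
    one to be picked, so the picked matrix has the defining properties. *)
Lemma psd_sqrt_laplacian (R : realType) n (alpha : R) (G : power_network R n) :
  0 < alpha -> let S := psd_sqrt (alpha *: laplacian G) in
  S^T *m S = alpha *: laplacian G.
Proof.
move=> alpha0 S.
suff : [set S : 'M[R]_n | [/\ S^T = S,
    (forall x : 'cV[R]_n, 0 <= (x^T *m S *m x) 0 0) &
    S *m S = alpha *: laplacian G]] S by case=> -> _.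
have [lam [charL lam_le]] := symmetric_sorted_eigenvalues (laplacian_sym G).
have [Q LQ] := symmetric_eigenbasis (laplacian_sym G) charL.
have lam0 := laplacian_eigenvalue_ge0 LQ.
have [QQ LE] := LQ.
pose r i := Num.sqrt (alpha * lam i).
apply: (@xgetPex _ 0 [set S | _] (ex_intro _ (Q *m diag_mx (\row_i r i) *m Q^T) _)).
have SQ : eigenbasis (Q *m diag_mx (\row_i r i) *m Q^T) Q r by [].
split.
- by rewrite !trmx_mul trmxK tr_diag_mx mulmxA.
- move=> x; rewrite -[X in 0 <= X]/(qform _ x) (qform_eigenbasis SQ) sumr_ge0 // => i _.
  by rewrite mulr_ge0 ?sqrtr_ge0 ?sqr_ge0.
- rewrite {1}LE -!mulmxA [Q^T *m (Q *m _)]mulmxA QQ mul1mx scalemxAr.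
  rewrite scalemxAl [diag_mx _ *m (diag_mx _ *m _)]mulmxA mulmx_diag.
  congr (_ *m (_ *m _)); apply/matrixP => i j; rewrite !mxE -expr2 sqr_sqrtr.
    by rewrite mulrnAr.
  by rewrite mulr_ge0 // ltW.
Qed.

(** * The loss as a sum over the eigenvalues *)

Definition mode_loss (R : realType) (alpha k tau q gamma eps l : R) : R :=
  eps ^+ 2 * (alpha / (2 * k)) *
  (1 / (gamma * l) * (1 / (1 + phi l gamma k q tau))).

Section Loss.
Variables (R : realType) (n : nat) (alpha k tau q gamma eps : R).
Hypotheses (alpha_gt0 : 0 < alpha) (k_gt0 : 0 < k) (tau_gt0 : 0 < tau)
  (q_gt0 : 0 < q) (gamma_gt0 : 0 < gamma).
Variables (G : power_network R n) (Q : 'M[R]_n) (lam : 'I_n -> R).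
Hypothesis LQ : eigenbasis (laplacian G) Q lam.
Local Notation theta i t := (mode_theta k tau q gamma (lam i) t).

(** The matrix exponential enters only through the block from the integral
    states to the phase angles, which is diagonal in the eigenbasis. *)
Lemma dapi_output_energy t :
  let h := dapi_output_mx alpha G *m mxexp (t *: dapi_state_mx k tau q gamma G)
           *m dapi_noise_mx n q eps in
  \tr (h^T *m h) = \sum_i (eps / q) ^+ 2 * alpha * lam i * (theta i t * theta i t).
Proof.
move=> h; have [QQ LE] := LQ.
have [T TE] : exists T, T = Q *m diag_mx (\row_i theta i t) *m Q^T by eexists.
have SS := psd_sqrt_laplacian G alpha_gt0.
have [S SE] : exists S, S = psd_sqrt (alpha *: laplacian G) by eexists.
rewrite -SE in SS.
have hE : h = (eps / q) *: (S *m T).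
  rewrite /h /dapi_noise_mx /dapi_output_mx -SE -mulmxA.
  have -> : mxexp (t *: dapi_state_mx k tau q gamma G) *m
      col_mx 0 (col_mx 0 (eps / q)%:M)
    = col_mx ((eps / q) *: T) (dsubmx (mxexp (t *: dapi_state_mx k tau q gamma G) *m
      col_mx 0 (col_mx 0 (eps / q)%:M))).
    rewrite -{1}[LHS]vsubmxK; congr col_mx; apply/matrixP => a b.
    rewrite -{1}[mxexp _]hsubmxK mul_row_col mulmx0 add0r.
    rewrite -{1}[rsubmx _]hsubmxK mul_row_col mulmx0 add0r.
    rewrite [RHS]mxE TE -(dapi_exp_theta_Omega k tau q gamma LQ).
    by rewrite mul_mx_scalar !mxE.
  by rewrite mul_row_col mul0mx addr0 scalemxAr.
rewrite hE -scalemxAr [(_ *: _)^T]linearZ /= -scalemxAl scalerA trmx_mul -mulmxA.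
rewrite [S^T *m _]mulmxA SS -scalemxAl -scalemxAr.
rewrite scalerA linearZ /= -expr2.
have -> : \tr (T^T *m (laplacian G *m T)) = \sum_i lam i * (theta i t * theta i t).
  rewrite {1}LE TE !trmx_mul trmxK tr_diag_mx -!mulmxA [Q^T *m (Q *m _)]mulmxA QQ.
  rewrite mul1mx [Q^T *m (Q *m _)]mulmxA QQ mul1mx mxtrace_mulC -!mulmxA QQ mulmx1.
  rewrite !mulmx_diag mxtrace_diag; apply: eq_bigr => i _.
  by rewrite !mxE; ring.
by rewrite mulr_sumr; apply: eq_bigr => i _; rewrite mulrA.
Qed.

(** The sum runs over all eigenvalues: a zero eigenvalue contributes [0] on
    both sides, the integrand having the factor [lam i] and [mode_loss] the
    factor [0^-1 = 0]. *)
Lemma dapi_noise_lossE : dapi_noise_loss alpha k tau q gamma eps G =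
  (\sum_i mode_loss alpha k tau q gamma eps (lam i))%:E.
Proof.
have lam_ge0 := laplacian_eigenvalue_ge0 LQ.
pose w i := (eps / q) ^+ 2 * alpha * lam i.
have w0 i : 0 <= w i by rewrite mulr_ge0 ?lam_ge0 // mulr_ge0 ?(ltW alpha_gt0) ?sqr_ge0.
have ctheta i : continuous (mode_theta k tau q gamma (lam i)).
  exact: continuous_mode_theta.
rewrite /dapi_noise_loss /H2_norm_sq.
under eq_integral do rewrite dapi_output_energy -sumEFin.
rewrite ge0_integral_sum //=; last 2 first.
- move=> i; apply/measurable_EFinP; apply: measurable_funTS.
  apply: continuous_measurable_fun => t.
  by apply: cvgM; [exact: cvg_cst|apply: cvgM; exact: ctheta].
- by move=> i t _; rewrite lee_fin mulr_ge0 ?w0 // -expr2 sqr_ge0.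
rewrite -sumEFin; apply: eq_bigr => i _.
have [l0|l0] := eqVneq (lam i) 0.
  rewrite integral0_eq => [|t _]; last by rewrite l0 mulr0 mul0r.
  by rewrite /mode_loss l0 mulr0 invr0 mulr0 mul0r mulr0.
have l_gt0 : 0 < lam i by rewrite lt0r l0 lam_ge0.
under eq_integral do rewrite EFinM.
rewrite ge0_integralZl_EFin //=; last 3 first.
- by move=> t _; rewrite lee_fin -expr2 sqr_ge0.
- apply/measurable_EFinP; apply: measurable_funTS.
  apply: continuous_measurable_fun => t.
  by apply: cvgM; exact: ctheta.
- exact: w0.
have [theta0 omega0 Omega0] := mode_initial_state k tau q gamma (lam i).
rewrite (integral_theta_sqr k_gt0 tau_gt0 q_gt0 gamma_gt0 l_gt0
  _ _ _ theta0 omega0 Omega0).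
all: try by move=> t; have [] := is_derive_mode k tau q gamma (lam i) t.
rewrite -EFinM; congr (_%:E); rewrite /theta_energy /mode_loss /phi.
have pos : 0 < q + tau * gamma * lam i by rewrite addr_gt0 ?mulr_gt0.
field; rewrite !gt_eqF // addr_gt0 // !addr_gt0 ?mulr_gt0 ?exprn_gt0 //.
Qed.

End Loss.

Lemma phi_ge0 (R : realType) (l gamma k q tau : R) :
  0 < gamma -> 0 < k -> 0 < q -> 0 < tau -> 0 < l -> 0 <= phi l gamma k q tau.
Proof.
move=> gamma_gt0 k_gt0 q_gt0 tau_gt0 l_gt0.
by rewrite /phi divr_ge0 // ?addr_ge0 ?mulr_ge0 ?exprn_ge0 ?ltW // !mulr_gt0.
Qed.

(** Up to a constant, [phi] is a linear function with positive slope minus a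
    positive multiple of [1 / (q + tau * gamma * l)]. *)
Lemma phi_le (R : realType) (l l' gamma k q tau : R) :
  0 < gamma -> 0 < k -> 0 < q -> 0 < tau -> 0 < l -> l <= l' ->
  phi l gamma k q tau <= phi l' gamma k q tau.
Proof.
move=> gamma_gt0 k_gt0 q_gt0 tau_gt0 l_gt0 ll'.
have l'_gt0 : 0 < l' by exact: lt_le_trans ll'.
have phiE m : 0 < m -> phi m gamma k q tau
    = gamma * m + k * q ^+ 2 / (tau * gamma) * (1 - q / (q + tau * gamma * m)).
  move=> m_gt0; rewrite /phi; field; rewrite !gt_eqF //.
  by rewrite addr_gt0 ?mulr_gt0.
rewrite !phiE //; apply: lerD; first by rewrite ler_pM2l.
rewrite ler_pM2l ?divr_gt0 ?mulr_gt0 ?exprn_gt0 // lerD2l lerN2 ler_pM2l //.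
rewrite lef_pV2 ?posrE ?addr_gt0 ?mulr_gt0 //.
by rewrite lerD2l ler_pM2l // mulr_gt0.
Qed.

Lemma mode_loss_le (R : realType) (alpha k tau q gamma eps l l' : R) :
  0 < alpha -> 0 < k -> 0 < tau -> 0 < q -> 0 < gamma -> 0 < l -> l <= l' ->
  mode_loss alpha k tau q gamma eps l' <= mode_loss alpha k tau q gamma eps l.
Proof.
move=> alpha_gt0 k_gt0 tau_gt0 q_gt0 gamma_gt0 l_gt0 ll'.
have l'_gt0 : 0 < l' by exact: lt_le_trans ll'.
have phi1 : 0 < 1 + phi l gamma k q tau by rewrite ltr_pwDl // phi_ge0.
have phi1' : 0 < 1 + phi l' gamma k q tau by rewrite ltr_pwDl // phi_ge0.
rewrite /mode_loss ler_wpM2l //.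
  by rewrite mulr_ge0 ?sqr_ge0 // divr_ge0 ?mulr_ge0 // ltW.
rewrite !div1r; apply: ler_pM.
- by rewrite invr_ge0 ltW ?mulr_gt0.
- by rewrite invr_ge0 ltW.
- by rewrite lef_pV2 ?posrE ?mulr_gt0 // ler_pM2l.
- by rewrite lef_pV2 ?posrE // lerD2l phi_le.
Qed.

Lemma mode_loss0 (R : realType) (alpha k tau q gamma eps : R) :
  mode_loss alpha k tau q gamma eps 0 = 0.
Proof. by rewrite /mode_loss mulr0 invr0 mulr0 mul0r mulr0. Qed.

Lemma dapi_noise_loss_le (R : realType) (n : nat) (alpha k tau q gamma eps : R)
    (G G' : power_network R n) :
  0 < alpha -> 0 < k -> 0 < tau -> 0 < q -> 0 < gamma ->
  (forall u v, susceptance G u v <= susceptance G' u v) ->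
  (dapi_noise_loss alpha k tau q gamma eps G' <=
   dapi_noise_loss alpha k tau q gamma eps G)%E.
Proof.
move=> alpha_gt0 k_gt0 tau_gt0 q_gt0 gamma_gt0 GG'.
have [lam [charL lam_le]] := symmetric_sorted_eigenvalues (laplacian_sym G).
have [Q LQ] := symmetric_eigenbasis (laplacian_sym G) charL.
have [lam' [charL' lam'_le]] := symmetric_sorted_eigenvalues (laplacian_sym G').
have [Q' LQ'] := symmetric_eigenbasis (laplacian_sym G') charL'.
rewrite (dapi_noise_lossE _ _ _ _ _ _ LQ) // (dapi_noise_lossE _ _ _ _ _ _ LQ') //.
rewrite lee_fin; apply: ler_sum => i _.
have [i0|i0] := eqVneq (i : nat) 0%N.
  rewrite (laplacian_first_eigenvalue LQ lam_le i0).
  by rewrite (laplacian_first_eigenvalue LQ' lam'_le i0).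
apply: mode_loss_le => //.
  by apply: (laplacian_eigenvalue_gt0 LQ lam_le); rewrite lt0n.
exact: eigenvalue_le LQ LQ' lam_le lam'_le (qform_laplacian_le GG') i.
Qed.

Theorem proposition3p6 (R : realType) (n : nat) (alpha k tau q gamma eps : R)
    (n_gt0 : (0 < n)%N) (alpha_gt0 : 0 < alpha) (k_gt0 : 0 < k)
    (tau_gt0 : 0 < tau) (q_gt0 : 0 < q) (gamma_gt0 : 0 < gamma)
    (eps_gt0 : 0 < eps) :
  [/\ forall (G : power_network R n) (lam : 'I_n -> R),
        ordered_eigenvalues (laplacian G) lam ->
        dapi_noise_loss alpha k tau q gamma eps G =
          (eps ^+ 2 * (alpha / (2 * k)) *
           \sum_(i < n | (0 < i)%N)
             1 / (gamma * lam i) * (1 / (1 + phi (lam i) gamma k q tau)))%:E,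
      forall (G G' : power_network R n) (i j : 'I_n),
        adds_edge i j G G' \/ increases_susceptance i j G G' ->
        (dapi_noise_loss alpha k tau q gamma eps G' <=
         dapi_noise_loss alpha k tau q gamma eps G)%E
    & forall (G G' : power_network R n) (i j : 'I_n),
        removes_edge i j G G' \/ decreases_susceptance i j G G' ->
        (dapi_noise_loss alpha k tau q gamma eps G <=
         dapi_noise_loss alpha k tau q gamma eps G')%E].
Proof.
split=> [G lam [charL lam_le]|G G' i j change|G G' i j change].
- have [Q LQ] := symmetric_eigenbasis (laplacian_sym G) charL.
  rewrite (dapi_noise_lossE _ _ _ _ _ _ LQ) //; congr (_%:E).
  rewrite mulr_sumr [RHS]big_mkcond /=; apply: eq_bigr => i _.
  rewrite lt0n; case: eqVneq => //= i0.
  by rewrite (laplacian_first_eigenvalue LQ lam_le i0) mode_loss0.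
- by apply: dapi_noise_loss_le => // u v; exact: adds_or_increases_le change u v.
- by apply: dapi_noise_loss_le => // u v; exact: removes_or_decreases_le change u v.
Qed.
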